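(* Let $p$ be a prime, let $1\le U,V<p$ be integers, let ${\mathfrak C}\subseteq[1,U]\times[1,V]$ be a convex set, and let $\{\alpha_u\}_{u=1}^U$, $\{\beta_v\}_{v=1}^V$ be complex numbers with $|\alpha_u|,|\beta_v|\le 1$. For $(a,b)\in{\mathbb F}_p^*\times{\mathbb F}_p$ define $$K_{a,b}({\mathcal A},{\mathcal B};{\mathfrak C})=\sum_{(u,v)\in{\mathfrak C}}\alpha_u\beta_v\,{\mathbf e}_p\big(v/(au+b)\big),$$ where the sum is over integer points $(u,v)\in{\mathfrak C}$ with $au+b\not\equiv0\pmod p$. Then, uniformly over $(a,b)\in{\mathbb F}_p^*\times{\mathbb F}_p$ and over $U,V,{\mathfrak C}$ and the weights, as $p\to\infty$, $$|K_{a,b}({\mathcal A},{\mathcal B};{\mathfrak C})|\le V^{3/4}\Big(U^{7/8}p^{1/8}+U^{1/2}p^{1/4}\Big)p^{o(1)}.$$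
   Context: ${\mathbf e}_p(z)=\exp(2\pi i z/p)$, where $v/(au+b)$ denotes an element of ${\mathbb F}_p$ represented by an integer in $\{0,\dots,p-1\}$. The notation $p^{o(1)}$ denotes a factor $p^{\epsilon(p)}$ with $\epsilon(p)\to0$ as $p\to\infty$. *)

(* Defs.v *)
From HB Require Import structures.
From mathcomp Require Import all_boot all_order all_algebra.
From mathcomp Require Import complex.
From mathcomp Require Import all_classical all_reals all_analysis.

Set Implicit Arguments.
Unset Strict Implicit.
Unset Printing Implicit Defensive.

Import Order.TTheory GRing.Theory Num.Theory.
Import numFieldNormedType.Exports.

Local Open Scope classical_set_scope.
Local Open Scope ring_scope.
Local Open Scope complex_scope.

Definition expC (R : realType) (z : R[i]) : R[i] :=
  (expR (complex.Re z))%:C * (cos (complex.Im z) +i* sin (complex.Im z)).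

Definition e_ (R : realType) (p : nat) (z : R) : R[i] :=
  expC ((2 * pi * z / p%:R)*i).

(* The quotient is taken in 'F_p; for p prime its value as an ordinal is the
   representative in {0, ..., p - 1}. When C is contained in [1, U] x [1, V],
   the ranges below enumerate all the integer points of C. *)
Definition Ksum (R : realType) (p U V : nat) (a b : 'F_p)
    (alpha beta : nat -> R[i]) (C : set (R^o * R^o)) : R[i] :=
  \sum_(1 <= u < U.+1)
    \sum_(1 <= v < V.+1 | (((u%:R, v%:R) : R^o * R^o) \in C)
                          && (a * u%:R + b != 0))
      alpha u * beta v
        * e_ p (nat_of_ord (v%:R / (a * u%:R + b) : 'F_p))%:R.

(* Main.v *)
(** For fixed v the integer points of the convex set form an interval of u, so
    that Hoelder's inequality in v gives |K|^4 <= V^3 sum_v |sum_u|^4.  A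
    Rademacher-Menshov dyadic decomposition replaces the v-dependent intervals by
    fixed dyadic blocks at the cost of powers of log U, and v is then extended to
    all of F_p.  By Parseval the fourth moment of a block is p times the number of
    solutions of 1/x1 + 1/x2 = 1/x3 + 1/x4 with each xi = a ui + b in the block.
    It remains to count, for s <> 0, the solutions of 1/x + 1/y = s, that is of
    (x - 1/s)(y - 1/s) = 1/s^2, or of (u + A)(v + A) = kappa <> 0 in F_p with
    u, v < N.  Dirichlet's theorem gives t <= T and a small c = t A mod p; the
    integer m = t u v + c (u + v) has a fixed residue mod p and size
    O(T N^2 + N p / T), so that, for T about sqrt(p / N), it takes
    O(1 + N^(3/2) p^(-1/2)) values.  Each of them determines the nonzero integer
    (t u + c)(t v + c) = c^2 + t m, and the divisor bound leaves p^o(1)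
    possibilities for (u, v). *)
Require Import Defs.
From mathcomp Require Import all_boot all_order all_algebra.
From mathcomp Require Import complex.
From mathcomp Require Import all_classical all_reals all_analysis.
From mathcomp Require Import zify ring lra.

Set Implicit Arguments.
Unset Strict Implicit.
Unset Printing Implicit Defensive.

Import Order.TTheory GRing.Theory Num.Theory.
Import numFieldNormedType.Exports.
Import Normc.

Lemma size_add_divisors (f : nat * nat) (s : seq nat) :
  size (PrimeDecompAux.add_divisors f s) = f.2.+1 * size s.
Proof.
case: f => q e /=; elim: e => [|e IHe] /=; first by rewrite mul1n.
by rewrite size_merge size_cat size_map IHe; lia.
Qed.

Lemma size_divisors (n : nat) :
  size (divisors n) = \prod_(f <- prime_decomp n) f.2.+1.
Proof.
rewrite /divisors; elim: (prime_decomp n) => [|f s IHs] /=.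
  by rewrite big_nil.
by rewrite size_add_divisors IHs big_cons.
Qed.

Lemma succ_expn_le (k e : nat) : 0 < k -> e.+1 ^ k <= k ^ k * 2 ^ e.
Proof.
move=> k0; apply: (@leq_trans ((k * 2 ^ (e %/ k)) ^ k)).
  rewrite leq_exp2r //; apply: (@leq_trans (k * (e %/ k).+1)).
    by rewrite mulnC; exact: ltn_ceil.
  by rewrite leq_mul2l ltn_expl ?orbT.
by rewrite expnMn leq_mul2l -expnM leq_exp2l // leq_divM orbT.
Qed.

Lemma succ_expn_le_pow (k q e : nat) : 0 < k -> 1 < q -> 0 < e ->
  e.+1 ^ k <= (if q < 2 ^ k then k ^ k else 1) * q ^ e.
Proof.
move=> k0 q1 e0; case: ltnP => [_|qk].
  apply: leq_trans (succ_expn_le e k0) _.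
  by rewrite leq_mul2l leq_exp2r // q1 orbT.
rewrite mul1n; apply: (@leq_trans ((2 ^ k) ^ e)); last by rewrite leq_exp2r.
by rewrite -expnM mulnC expnM leq_exp2r // ltn_expl.
Qed.

Lemma prod_const_ltn_le (s : seq nat) (c m : nat) : uniq s -> 0 < c ->
  \prod_(q <- s | q < m) c <= c ^ m.
Proof.
move=> us c0; rewrite big_const_seq iter_muln muln1 leq_pexp2l //.
rewrite -size_filter -[leqRHS](size_iota 0).
apply: uniq_leq_size; first exact: filter_uniq.
by move=> q; rewrite mem_filter mem_iota => /andP[].
Qed.

(* Comparing [(e + 1) ^ k] with [q ^ e] prime by prime, only the primes
   [q < 2 ^ k] lose a constant. *)
Lemma size_divisors_exp_le (k n : nat) : 0 < k -> 0 < n ->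
  size (divisors n) ^ k <= (k ^ k) ^ (2 ^ k) * n.
Proof.
move=> k0 n0; rewrite size_divisors.
rewrite (big_morph (expn^~ k) (fun x y => expnMn x y k) (exp1n k)).
apply: (@leq_trans (\prod_(f <- prime_decomp n)
    ((if f.1 < 2 ^ k then k ^ k else 1) * f.1 ^ f.2))).
  rewrite big_seq [leqRHS]big_seq; apply: leq_prod => -[q e].
  move=> /mem_prime_decomp[pq e0 _].
  by rewrite succ_expn_le_pow // prime_gt1.
rewrite big_split /= -(prod_prime_decomp n0) leq_mul2r -big_mkcond /=.
rewrite -(big_map fst (fun q => q < 2 ^ k) (fun=> k ^ k)).
by rewrite prod_const_ltn_le ?expn_gt0 ?k0 ?orbT // -/(unzip1 _) primes_uniq.
Qed.

(* [divisors 0 = [:: 1]], hence the index 0 is harmless. *)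
Definition max_divisors (N : nat) : nat := \max_(n < N.+1) size (divisors n).

Lemma size_divisors_le_max (N n : nat) : n <= N ->
  size (divisors n) <= max_divisors N.
Proof.
by move=> nN; rewrite /max_divisors (bigop.leq_bigmax (Ordinal (nN : n < N.+1))).
Qed.

Lemma max_divisors_gt0 (N : nat) : 0 < max_divisors N.
Proof. exact: (@size_divisors_le_max N 0). Qed.

Lemma max_divisors_exp_le (k N : nat) : 0 < k -> 0 < N ->
  max_divisors N ^ k <= (k ^ k) ^ (2 ^ k) * N.
Proof.
move=> k0 N0; rewrite /max_divisors.
have [|[[|n] nN] ->] := @bigop.eq_bigmax _ (fun n : 'I_N.+1 => size (divisors n)).
- by rewrite card_ord.
- by rewrite exp1n muln_gt0 !expn_gt0 k0 N0.
apply: leq_trans (size_divisors_exp_le k0 _) _ => //.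
by rewrite leq_mul2l -ltnS nN orbT.
Qed.

Lemma ltn_max_divisors (m N : nat) : 2 ^ m <= N -> m < max_divisors N.
Proof.
move=> mN; apply: leq_trans (size_divisors_le_max mN).
rewrite -[leqLHS](size_iota 0) -(size_map (expn 2)).
apply: uniq_leq_size; first by rewrite map_inj_uniq ?iota_uniq //; exact: expnI.
move=> k /mapP[j]; rewrite mem_iota => /andP[_ jm] ->.
by rewrite -dvdn_divisors ?expn_gt0 // dvdn_exp2l.
Qed.

Lemma card_fibers_le (I J : finType) (A : {pred I}) (f : I -> J) (k : nat) :
  (forall j, #|[pred i in A | f i == j]| <= k) -> #|A| <= #|J| * k.
Proof.
move=> fk; rewrite -sum1_card (partition_big f predT) //= -sum_nat_const.
by apply: leq_sum => j _; rewrite sum1_card; exact: fk.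
Qed.

Lemma exists_sqrt_ratio (N p : nat) : 0 < N <= p ->
  exists2 T, 0 < T & N * T ^ 2 <= p <= 4 * (N * T ^ 2).
Proof.
move=> /andP[N0 Np].
have exT : exists T, N * T ^ 2 <= p by exists 0; rewrite muln0.
have bT T : N * T ^ 2 <= p -> T <= p by rewrite expnS expn1; nia.
have [T Tle Tmax] := ex_maxnP exT bT.
have T0 : 0 < T by apply: Tmax; rewrite muln1.
exists T => //; rewrite Tle /=.
have : p < N * T.+1 ^ 2 by rewrite ltnNge; apply/negP => /Tmax; rewrite ltnn.
move=> /ltnW /leq_trans; apply; rewrite mulnCA leq_mul2l; apply/orP; right.
by rewrite -[4]/(2 ^ 2) -expnMn leq_exp2r // mul2n -addnn -add1n leq_add2r.
Qed.

Local Open Scope classical_set_scope.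
Local Open Scope ring_scope.
Local Open Scope complex_scope.

Lemma card_factorizations (I J : finType) (f : I -> int) (g : J -> int) (n : int) :
  injective f -> injective g -> n != 0 ->
  (#|[pred z | (f z.1 * g z.2)%R == n]| <= 2 * size (divisors `|n|))%N.
Proof.
move=> f_inj g_inj n0; set S := [pred z | _]; pose D := divisors `|n|.
have f_injS : {in S &, injective (fun z : I * J => f z.1)}.
  move=> [i j] [i' j'] /eqP /= ij /eqP /= ij' /f_inj ii'; rewrite ii' in ij *.
  have fi0 : f i' != 0 by apply: contraNneq n0 => fi0; rewrite -ij fi0 mul0r.
  by congr pair; apply/g_inj/(mulfI fi0); rewrite ij ij'.
have -> : (2 * size D = size ([seq d%:Z | d <- D] ++ [seq - d%:Z | d <- D]))%N.
  by rewrite size_cat !size_map mul2n addnn.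
rewrite cardE -(size_map (fun z => f z.1)); apply: uniq_leq_size.
  rewrite map_inj_in_uniq ?enum_uniq // => z z'; rewrite !mem_enum.
  exact: f_injS.
move=> x /mapP[z]; rewrite mem_enum => /eqP zn ->.
have fD : `|f z.1|%N \in D.
  by rewrite -dvdn_divisors ?absz_gt0 // -zn abszM dvdn_mulr.
rewrite mem_cat; apply/orP.
have [f0|f0] := leP 0 (f z.1); [left|right]; apply/mapP; exists `|f z.1|%N => //.
  by rewrite gez0_abs.
by rewrite ltz0_abs // opprK.
Qed.

Lemma card_bounded_residue (I : finType) (A : {pred I}) (f : I -> int)
    (n X k : nat) :
  {in A, forall i, (`|f i| <= X)%N} ->
  {in A &, forall i j, (f i = f j %[mod n])%Z} ->
  (forall m, (#|[pred i in A | f i == m]| <= k)%N) ->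
  (#|A| <= ((2 * X) %/ n).+1 * k)%N.
Proof.
move=> fX f_mod fk; pose h i := `|(f i + X%:Z)%R|%N.
have hE i : i \in A -> h i = f i + X%:Z :> int by move=> /fX; rewrite /h; lia.
have h_mod : {in A &, forall i j, h i = h j %[mod n]}.
  move=> i j iA jA; apply/eqP; rewrite -eqz_nat -!modz_nat !hE //.
  by rewrite eqz_modDr; apply/eqP/f_mod.
have h_div i : i \in A -> (h i %/ n < ((2 * X) %/ n).+1)%N.
  by move=> iA; rewrite ltnS leq_div2r //; have := fX i iA; rewrite /h; lia.
pose code i : 'I_((2 * X) %/ n).+1 := inord (h i %/ n).
rewrite -[X in (X * k)%N]card_ord; apply: (card_fibers_le (f := code)) => q.
have [i /andP[iA /eqP iq]|none] := pickP [pred i in A | code i == q]; last first.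
  by rewrite eq_card0.
apply: leq_trans (fk (f i)); apply/subset_leq_card/fintype.subsetP => j.
move=> /andP[/= jA /eqP jq]; rewrite inE jA /=; apply/eqP.
have /(congr1 val) : code j = code i by rewrite iq jq.
rewrite /= !inordK ?h_div // => eq_div.
have : h j = h i.
  by rewrite (divn_eq (h j) n) (divn_eq (h i) n) eq_div (h_mod j i).
by move=> /(congr1 Posz); rewrite !hE // => /addIr.
Qed.

Lemma dirichlet_mod (n T a : nat) : (0 < n)%N -> (0 < T)%N ->
  exists t (c : int),
    [/\ (0 < t <= T)%N, (c = (t * a)%N %[mod n])%Z & (`|c| * T < n)%N].
Proof.
move=> n0 T0; pose r t := ((t * a) %% n)%N.
have box_lt t : ((r t * T) %/ n < T)%N.
  by rewrite ltn_divLR // mulnC ltn_pmul2l ?ltn_pmod.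
have [t1 [t2 [t12 eq_box]]] : exists t1 t2 : 'I_T.+1,
    (t1 < t2)%N /\ ((r t1 * T) %/ n = (r t2 * T) %/ n)%N.
  have /injectivePn[x [y xy [fxy]]] :
      ~~ injectiveb (fun t : 'I_T.+1 => Ordinal (box_lt t)).
    by apply/injectiveP => /leq_card; rewrite !card_ord ltnn.
  have : (x : nat) != y by [].
  by rewrite neq_ltn => /orP[] lt_xy; [exists x, y | exists y, x].
exists (t2 - t1)%N, ((r t2)%:Z - (r t1)%:Z); split.
- have := ltn_ord t2; lia.
- apply/eqP; rewrite mulnBl -subzn ?leq_mul2r ?(ltnW t12) ?orbT //.
  by rewrite /r -!modz_nat modzDml -modzDmr modzNm modzDmr.
- have := divn_eq (r t1 * T) n; have := divn_eq (r t2 * T) n; rewrite -eq_box.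
  have := ltn_pmod (r t1 * T) n0; have := ltn_pmod (r t2 * T) n0.
  move: (_ %/ _)%N (_ %% _)%N (_ %% _)%N => q x y; nia.
Qed.

Lemma intr_Fp_eq (p : nat) (m n : int) : prime p ->
  (m%:~R == n%:~R :> 'F_p) = (m == n %[mod p])%Z.
Proof.
by move=> p_pr; rewrite eqz_mod_dvd (dvdz_pcharf (pchar_Fp p_pr)) rmorphB subr_eq0.
Qed.

Definition hyperbola_points (p N : nat) (A kappa : 'F_p) : {set 'I_N * 'I_N} :=
  [set z : 'I_N * 'I_N | (z.1%:R + A) * (z.2%:R + A) == kappa].

(* If [c = t A] in ['F_p], then [(t u + c) (t v + c) = c ^ 2 + t m] for the integer
   [m = t u v + c (u + v)]: on the hyperbola [m] has a fixed residue modulo [p], and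
   each value of [m] leaves only the factorizations of a nonzero integer. *)
Section LiftedHyperbola.
Variables (p N t : nat) (c : int) (A kappa : 'F_p).
Hypotheses (p_pr : prime p) (Np : (N <= p)%N) (t_lt : (0 < t < p)%N).
Hypotheses (c_lt : (`|c| < p)%N) (cA : c%:~R = t%:R * A) (kappa0 : kappa != 0).

Definition lifted_factor (u : 'I_N) : int := t%:Z * u%:Z + c.

Definition lifted_sum (z : 'I_N * 'I_N) : int :=
  t%:Z * z.1%:Z * z.2%:Z + c * (z.1%:Z + z.2%:Z).

Lemma lifted_factorM (z : 'I_N * 'I_N) :
  lifted_factor z.1 * lifted_factor z.2 = c ^+ 2 + t%:Z * lifted_sum z.
Proof. by rewrite /lifted_factor /lifted_sum; ring. Qed.

Lemma lifted_factor_inj : injective lifted_factor.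
Proof.
move=> u v /addIr /mulfI uv; apply/val_inj; suff [] : u%:Z = v%:Z by [].
by apply: uv; rewrite -lt0n; case/andP: t_lt.
Qed.

Lemma lifted_factor_le (u : 'I_N) : (`|lifted_factor u| <= p ^ 2)%N.
Proof. have := ltn_ord u; rewrite /lifted_factor expnS expn1; nia. Qed.

Lemma lifted_factorM_neq0 (z : 'I_N * 'I_N) :
  z \in hyperbola_points N A kappa -> lifted_factor z.1 * lifted_factor z.2 != 0.
Proof.
rewrite inE => /eqP z_kappa.
have t_neq0 : (t%:R : 'F_p) != 0.
  by rewrite -(dvdn_pcharf (pchar_Fp p_pr)); apply/negP => /dvdn_leq; lia.
apply: contraNneq kappa0 => /(congr1 (fun x : int => x%:~R : 'F_p)).
rewrite /lifted_factor !(rmorphM, rmorphD) /= cA -!pmulrn -!mulrDr mulrACA z_kappa.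
by move=> /eqP; rewrite !mulf_eq0 (negPf t_neq0).
Qed.

Lemma lifted_sum_mod : {in hyperbola_points N A kappa &,
  forall z z', (lifted_sum z = lifted_sum z' %[mod p])%Z}.
Proof.
have residue z : z \in hyperbola_points N A kappa ->
    (lifted_sum z)%:~R = t%:R * (kappa - A ^+ 2) :> 'F_p.
  rewrite inE => /eqP <-; rewrite /lifted_sum !(rmorphM, rmorphD) /= cA -!pmulrn.
  by ring.
by move=> z z' zS z'S; apply/eqP; rewrite -intr_Fp_eq // !residue.
Qed.

Lemma card_lifted_sum_fiber_le (m : int) :
  (#|[pred z in hyperbola_points N A kappa | lifted_sum z == m]| <=
   2 * max_divisors (p ^ 4))%N.
Proof.
have [z /andP[/= zS /eqP zm]|none] :=
  pickP [pred z in hyperbola_points N A kappa | lifted_sum z == m]; last first.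
  by rewrite eq_card0.
pose n := lifted_factor z.1 * lifted_factor z.2.
apply: (@leq_trans (2 * size (divisors `|n|))); last first.
  rewrite leq_mul2l size_divisors_le_max // abszM (expnD p 2 2).
  by rewrite leq_mul ?lifted_factor_le.
apply: leq_trans (card_factorizations lifted_factor_inj lifted_factor_inj _).
  apply/subset_leq_card/fintype.subsetP => z' /andP[_ /= /eqP z'm].
  by rewrite inE /n !lifted_factorM zm z'm.
exact: lifted_factorM_neq0.
Qed.

End LiftedHyperbola.

Lemma card_hyperbola_dirichlet (p N T : nat) (A kappa : 'F_p) :
  prime p -> (N <= p)%N -> (0 < T < p)%N -> kappa != 0 ->
  (#|hyperbola_points N A kappa| <=
   ((2 * (T * N ^ 2 + 2 * N * (p %/ T))) %/ p).+1 * (2 * max_divisors (p ^ 4)))%N.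
Proof.
move=> p_pr Np /andP[T0 Tp] kappa0; have p0 := prime_gt0 p_pr.
have [t [c [/andP[t0 tT] c_mod cT]]] := dirichlet_mod (A : nat) p0 T0.
have cA : c%:~R = t%:R * A.
  rewrite -[A in RHS]natr_Zp -natrM [RHS]pmulrn.
  by apply/eqP; rewrite intr_Fp_eq // c_mod.
have c_le : (`|c| <= p %/ T)%N by rewrite leq_divRL // ltnW.
have c_lt : (`|c| < p)%N by apply: leq_ltn_trans cT; rewrite leq_pmulr.
have t_lt : (0 < t < p)%N by rewrite t0 (leq_ltn_trans tT).
apply: (@card_bounded_residue _ _ (lifted_sum t c)) => [z _||m].
- have [uN vN] := (ltn_ord z.1, ltn_ord z.2).
  have abszD_le (x y : int) : (`|(x + y)%R| <= `|x| + `|y|)%N by lia.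
  rewrite /lifted_sum -!PoszM -PoszD (leq_trans (abszD_le _ _)) // abszM -mulnA.
  rewrite leq_add //; first by rewrite leq_mul // expnS expn1 leq_mul // ltnW.
  by rewrite [leqRHS]mulnC leq_mul // mul2n -addnn leq_add // ltnW.
- exact: lifted_sum_mod.
- exact: card_lifted_sum_fiber_le.
Qed.

Lemma natr_le_sqrt (R : rcfType) (m n : nat) : (m ^ 2 <= n)%N ->
  m%:R <= Num.sqrt n%:R :> R.
Proof.
move=> mn; rewrite -[leLHS]ger0_norm // -sqrtr_sqr ler_sqrt //.
by rewrite -natrX ler_nat.
Qed.

(* The choice [T ~ sqrt (p / N)] balances the two terms of the previous bound. *)
Lemma card_hyperbola_le (R : rcfType) (p N : nat) (A kappa : 'F_p) :
  prime p -> (0 < N <= p)%N -> kappa != 0 ->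
  p%:R * #|hyperbola_points N A kappa|%:R <=
  (10 * Num.sqrt (p * N ^ 3)%:R + p%:R) * (2 * max_divisors (p ^ 4))%:R :> R.
Proof.
move=> p_pr N0p k0; have p1 := prime_gt1 p_pr.
have [T T0 /andP[NTp pNT]] := exists_sqrt_ratio N0p.
case/andP: N0p => N0 Np.
have Tp : (T < p)%N by move: NTp; rewrite expnS expn1; nia.
have T0p : (0 < T < p)%N by rewrite T0.
have := card_hyperbola_dirichlet A p_pr Np T0p k0.
set X := (T * N ^ 2 + _)%N; set D := (2 * max_divisors _)%N => cardX.
apply: (@le_trans _ _ ((2 * X + p) * D)%:R).
  rewrite -natrM ler_nat (leq_trans (leq_mul (leqnn p) cardX)) // [leqLHS]mulnA.
  rewrite leq_mul2r; apply/orP; right.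
  by rewrite mulnS addnC leq_add2r mulnC leq_divM.
have TN_le : (T * N ^ 2)%:R <= Num.sqrt (p * N ^ 3)%:R :> R.
  apply: natr_le_sqrt; rewrite (_ : (T * N ^ 2) ^ 2 = N * T ^ 2 * N ^ 3)%N.
    by rewrite leq_mul2r NTp orbT.
  by ring.
have NpT_le : (N * (p %/ T))%:R <= Num.sqrt (4 * (p * N ^ 3))%:R :> R.
  apply: natr_le_sqrt; rewrite -(leq_pmul2r (_ : 0 < T ^ 2)%N) ?expn_gt0 ?T0 //.
  rewrite -expnMn -mulnA (leq_trans (_ : _ <= (N * p) ^ 2)%N) //.
    by rewrite leq_exp2r // leq_mul2l leq_divM orbT.
  rewrite (_ : 4 * (p * N ^ 3) * T ^ 2 = N ^ 2 * p * (4 * (N * T ^ 2)))%N;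
    last by ring.
  by rewrite expnMn (expnS p) expn1 mulnA leq_mul2l pNT orbT.
have sqrt4 : Num.sqrt (4 * (p * N ^ 3))%:R = 2 * Num.sqrt (p * N ^ 3)%:R :> R.
  by rewrite natrM sqrtrM // (_ : 4 = 2 ^+ 2) ?sqrtr_sqr ?ger0_norm // -natrX.
rewrite natrM ler_wpM2r // /X !natrD natrM -mulnA.
by move: TN_le NpT_le; rewrite sqrt4 !natrM; lra.
Qed.

Lemma normc_ge0 (R : rcfType) (z : R[i]) : 0 <= normc z.
Proof. exact: (normr_ge0 (z : Rcomplex R)). Qed.

Lemma normc_sqr (R : rcfType) (z : R[i]) : (normc z ^+ 2)%:C = z * z^*%C.
Proof. by rewrite -sqr_normc rmorphXn. Qed.

Lemma normc_sum_le (R : rcfType) (I : Type) (r : seq I) (P : pred I)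
    (F : I -> R[i]) :
  normc (\sum_(i <- r | P i) F i) <= \sum_(i <- r | P i) normc (F i).
Proof. exact: (ler_norm_sum (V := Rcomplex R)). Qed.

Section AdditiveCharacter.
Variables (R : realType) (p : nat).
Hypothesis p_pr : prime p.

Definition chi (x : 'F_p) : R[i] := e_ p (nat_of_ord x)%:R.

Let angle (z : R) := 2 * pi * z / p%:R.

Lemma e_cos_sin (z : R) : e_ p z = cos (angle z) +i* sin (angle z).
Proof. by rewrite /e_ /expC /= expR0 mul1r. Qed.

Lemma e_add (y z : R) : e_ p (y + z) = e_ p y * e_ p z.
Proof.
rewrite !e_cos_sin /angle mulrDr mulrDl cosD sinD; apply/eqP.
by rewrite eq_complex /= eqxx addrC /= mulrC [X in _ + X]mulrC.
Qed.

Lemma e_natr (n : nat) : e_ p (n%:R : R) = e_ p 1 ^+ n.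
Proof.
elim: n => [|n IHn]; last by rewrite -addn1 natrD e_add IHn addn1 exprSr.
by rewrite e_cos_sin /angle mulr0 mul0r cos0 sin0.
Qed.

Lemma e_1_expp : e_ p (1 : R) ^+ p = 1.
Proof.
rewrite -e_natr e_cos_sin /angle mulfK ?pnatr_eq0 -?lt0n ?prime_gt0 //.
by rewrite mulr_natl cos2pi sin2pi.
Qed.

Lemma chi_natr (n : nat) : chi n%:R = e_ p n%:R.
Proof. by rewrite /chi val_Fp_nat // !e_natr expr_mod // e_1_expp. Qed.

Lemma chiD (x y : 'F_p) : chi (x + y) = chi x * chi y.
Proof. by rewrite -(natr_Zp x) -(natr_Zp y) -natrD !chi_natr natrD e_add. Qed.

Lemma chi0 : chi 0 = 1.
Proof. by rewrite /chi e_natr expr0. Qed.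

Lemma normc_chi (x : 'F_p) : normc (chi x) = 1.
Proof. by rewrite /chi e_cos_sin /= cos2Dsin2 sqrtr1. Qed.

Lemma chi_conj (x : 'F_p) : (chi x)^*%C = chi (- x).
Proof.
have chi_neq0 : chi x != 0.
  by apply: contra_eq_neq (normc_chi x) => ->; rewrite normc0 eq_sym oner_neq0.
by apply: (mulfI chi_neq0); rewrite -normc_sqr normc_chi expr1n -chiD subrr chi0.
Qed.

(* [2 pi x / p = 2 y] with [0 < y < pi], whence [cos (2 y) = 1 - 2 (sin y)^2]
   is less than [1]. *)
Lemma chi_neq1 (x : 'F_p) : x != 0 -> chi x != 1.
Proof.
move=> x0; have n0 : (0 < x)%N by rewrite lt0n.
have np : (x < p)%N by rewrite -[X in (_ < X)%N](Fp_cast p_pr) ltn_ord.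
have p0 : 0 < p%:R :> R by rewrite ltr0n prime_gt0.
pose y : R := pi * (x : nat)%:R / p%:R.
have siny : 0 < sin y.
  apply: sin_gt0_pi.
  rewrite divr_gt0 ?mulr_gt0 ?pi_gt0 ?(ltr0n _ (nat_of_ord x)) //=.
  by rewrite ltr_pdivrMr // ltr_pM2l ?pi_gt0 // ltr_nat.
apply/eqP; rewrite /chi e_cos_sin (_ : angle _ = y *+ 2);
  last by rewrite /angle /y; ring.
rewrite cos_mulr2n cos2sin2 => -[] cos1 _.
by have := exprn_gt0 2 siny; lra.
Qed.

Lemma chi_sum (h : 'F_p) : \sum_x chi (x * h) = if h == 0 then p%:R else 0.
Proof.
case: eqP => [->|/eqP h0].
  under eq_bigr do rewrite mulr0 chi0.
  by rewrite sumr_const card_Fp.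
set S := LHS; have shift : chi h * S = S.
  rewrite mulr_sumr [RHS](reindex_inj (addIr 1)) /=.
  by apply: eq_bigr => x _; rewrite -chiD mulrDl mul1r addrC.
apply/eqP; move/eqP: shift; rewrite -subr_eq0 -[X in _ - X]mul1r -mulrBl.
by rewrite mulf_eq0 subr_eq0 (negPf (chi_neq1 h0)).
Qed.

Lemma parseval (g : 'F_p -> R[i]) :
  \sum_x normc (\sum_s g s * chi (x * s)) ^+ 2 = p%:R * \sum_s normc (g s) ^+ 2.
Proof.
have expand x : (normc (\sum_s g s * chi (x * s)) ^+ 2)%:C =
    \sum_s \sum_s' g s * (g s')^*%C * chi (x * (s - s')).
  have conjcM (y z : R[i]) : (y * z)^*%C = y^*%C * z^*%C by exact: (rmorphM conjc).
  rewrite normc_sqr [X in _ * X](rmorph_sum conjc) big_distrlr.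
  apply: eq_bigr => s _; apply: eq_bigr => s' _.
  by rewrite /= conjcM chi_conj mulrACA -chiD -mulrN -mulrDr.
apply: (@complexI R); rewrite rmorph_sum rmorphM rmorph_nat rmorph_sum /=.
rewrite (eq_bigr _ (fun x _ => expand x)).
rewrite exchange_big mulr_sumr /=; apply: eq_bigr => s _.
rewrite exchange_big /=; under eq_bigr do rewrite -mulr_sumr chi_sum subr_eq0.
rewrite (bigD1 s) //= eqxx big1 ?addr0 => [|s' ss'].
  by rewrite -normc_sqr mulrC.
by rewrite eq_sym (negPf ss') mulr0.
Qed.

End AdditiveCharacter.

Section AdditiveEnergy.
Variables (G : finZmodType) (I : finType) (P : {pred I}) (w : I -> G).

Definition add_reps (s : G) : {set I * I} :=
  [set z : I * I | [&& z.1 \in P, z.2 \in P & w z.1 + w z.2 == s]].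

Definition additive_energy : nat := (\sum_s #|add_reps s| ^ 2)%N.

Lemma sum_card_add_reps : (\sum_s #|add_reps s| = #|P| ^ 2)%N.
Proof.
rewrite expnS expn1 -cardX -sum1_card.
rewrite (partition_big (fun z => w z.1 + w z.2) predT) //=.
apply: eq_bigr => s _; rewrite -sum1_card.
by apply: eq_bigl => z; rewrite inE andbA.
Qed.

Hypothesis w_inj : {in P &, injective w}.

Lemma card_add_reps_le (s : G) : (#|add_reps s| <= #|P|)%N.
Proof.
have fst_inj : {in add_reps s &, injective (fst : I * I -> I)}.
  move=> [i j] [i' j'] /=; rewrite !inE /= => /and3P[_ Pj /eqP ij].
  move=> /and3P[_ Pj' /eqP ij'] ii'; congr pair => //.
  by apply: w_inj => //; move: ij; rewrite -ij' ii' => /addrI.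
rewrite -(card_in_imset fst_inj); apply/subset_leq_card/fintype.subsetP => i.
by move=> /imsetP[z]; rewrite inE => /and3P[Pz _ _] ->.
Qed.

(* For [s = 0] only the trivial bound by [#|P|] is available, whence [M + 1]. *)
Lemma additive_energy_le (R : numDomainType) (M : R) :
  (forall s, s != 0 -> #|add_reps s|%:R <= M) -> 0 <= M ->
  additive_energy%:R <= #|P|%:R ^+ 2 * (M + 1).
Proof.
move=> repsM M0; rewrite natr_sum mulrDr mulr1 addrC (bigD1 0) //= lerD //.
  by rewrite natrX lerXn2r ?nnegrE ?ler_nat ?card_add_reps_le.
rewrite -natrX -sum_card_add_reps natr_sum mulr_suml.
rewrite [leRHS](bigD1 0) //= ler_wpDl ?mulr_ge0 //.
by apply: ler_sum => s s0; rewrite natrX ler_wpM2l ?repsM.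
Qed.

End AdditiveEnergy.

Section FourthMoment.
Variables (R : realType) (p : nat) (I : finType) (P : {pred I}).
Variables (c : I -> R[i]) (w : I -> 'F_p).
Hypothesis p_pr : prime p.
Hypothesis c_le1 : {in P, forall i, normc (c i) <= 1}.

Lemma sqr_exponential_sum (x : 'F_p) :
  (\sum_(i in P) c i * chi R (x * w i)) ^+ 2 =
  \sum_s (\sum_(z in add_reps P w s) c z.1 * c z.2) * chi R (x * s).
Proof.
rewrite expr2 big_distrlr pair_big /=.
rewrite (partition_big (fun z => w z.1 + w z.2) predT) //=.
apply: eq_bigr => s _; rewrite mulr_suml; apply: eq_big => z.
  by rewrite inE andbA.
by move=> /andP[_ /eqP <-]; rewrite mulrACA -chiD // mulrDr.
Qed.

Lemma fourth_moment_le :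
  \sum_x normc (\sum_(i in P) c i * chi R (x * w i)) ^+ 4 <=
  p%:R * (additive_energy P w)%:R.
Proof.
have pow4_sqr (z : R[i]) : normc z ^+ 4 = normc (z ^+ 2) ^+ 2.
  by rewrite (exprM _ 2 2) !expr2 normcM.
under eq_bigr do rewrite pow4_sqr sqr_exponential_sum.
rewrite parseval // ler_wpM2l // natr_sum; apply: ler_sum => s _.
rewrite natrX ler_sqr ?nnegrE ?normc_ge0 //.
apply: le_trans (normc_sum_le _ _ _) _.
rewrite -sum1_card natr_sum; apply: ler_sum => z; rewrite inE => /and3P[z1 z2 _].
by rewrite normcM mulr_ile1 ?normc_ge0 ?c_le1.
Qed.

End FourthMoment.

Lemma sqr_sum_le (R : realDomainType) (I : finType) (x : I -> R) :
  (\sum_i x i) ^+ 2 <= #|I|%:R * \sum_i x i ^+ 2.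
Proof.
rewrite -(@ler_pMn2r _ 2) // expr2 big_distrlr -sumrMnl /=.
apply: (@le_trans _ _ (\sum_i \sum_j (x i ^+ 2 + x j ^+ 2))).
  apply: ler_sum => i _; rewrite -sumrMnl; apply: ler_sum => j _.
  exact: leif_mean_square_scaled.
under [leLHS]eq_bigr do rewrite big_split sumr_const /=.
by rewrite big_split sumr_const sumrMnl /= mulr2n mulr_natl.
Qed.

Lemma pow4_sum_le (R : realDomainType) (I : finType) (x : I -> R) :
  (\sum_i x i) ^+ 4 <= #|I|%:R ^+ 3 * \sum_i x i ^+ 4.
Proof.
rewrite [_ ^+ 4](exprM _ 2 2).
apply: (@le_trans _ _ ((#|I|%:R * \sum_i x i ^+ 2) ^+ 2)).
  rewrite ler_sqr ?nnegrE ?sqr_ge0 ?sqr_sum_le //.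
  by rewrite mulr_ge0 // sumr_ge0 // => i _; exact: sqr_ge0.
rewrite exprMn (exprSr _ 2) -mulrA ler_wpM2l ?exprn_ge0 //.
apply: le_trans (sqr_sum_le _) _.
by under [in leRHS]eq_bigr do rewrite (exprM _ 2 2).
Qed.

Section DyadicChaining.
Variables (R : realDomainType) (V : normedZmodType R) (K : nat).
Implicit Types f : nat -> V.

Definition dyadic_level_pow4 f (j : nat) : R :=
  \sum_(b < 2 ^ (K - j)) `|f (b.+1 * 2 ^ j)%N - f (b * 2 ^ j)%N| ^+ 4.

Definition dyadic_pow4_sum f : R := \sum_(j < K) dyadic_level_pow4 f j.

Lemma dyadic_increment_pow4_le f (j n : nat) : (j < K)%N -> (n < 2 ^ K)%N ->
  `|f (n %/ 2 ^ j * 2 ^ j)%N - f (n %/ 2 ^ j.+1 * 2 ^ j.+1)%N| ^+ 4 <=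
  dyadic_level_pow4 f j.
Proof.
move=> jK nK; set q := (n %/ 2 ^ j)%N.
have qK : (q < 2 ^ (K - j))%N.
  by rewrite ltn_divLR ?expn_gt0 // -expnD subnK // ltnW.
have -> : (n %/ 2 ^ j.+1 * 2 ^ j.+1 = (q - odd q) * 2 ^ j)%N.
  rewrite expnSr divnMA divn2 -/q mulnCA mulnC muln2 -{2}(odd_double_half q).
  by rewrite addKn.
have [q_odd|q_even] := boolP (odd q); last first.
  by rewrite subn0 subrr normr0 expr0n sumr_ge0 // => b _; rewrite exprn_ge0.
case: q qK q_odd => // q qK _; rewrite subn1 /=.
rewrite /dyadic_level_pow4 (bigD1 (Ordinal (ltnW qK))) //= lerDl.
by apply: sumr_ge0 => b _; rewrite exprn_ge0.
Qed.

(* [f n - f 0] telescopes along the truncations [n %/ 2 ^ j * 2 ^ j] of the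
   binary expansion of [n]. *)
Lemma dyadic_prefix_pow4_le f (n : nat) : (n < 2 ^ K)%N ->
  `|f n - f 0%N| ^+ 4 <= K%:R ^+ 3 * dyadic_pow4_sum f.
Proof.
move=> nK; pose g j := f (n %/ 2 ^ j * 2 ^ j)%N.
have -> : f n - f 0%N = \sum_(j < K) (g j - g j.+1).
  rewrite -[LHS]opprB -[RHS]opprK -sumrN; congr (- _).
  under eq_bigr do rewrite opprB.
  rewrite -(big_mkord xpredT (fun j => g j.+1 - g j)) telescope_sumr //.
  by rewrite /g divn_small // mul0n divn1 muln1.
apply: (@le_trans _ _ ((\sum_(j < K) `|g j - g j.+1|) ^+ 4)).
  by rewrite lerXn2r ?nnegrE ?sumr_ge0 // ler_norm_sum.
apply: le_trans (pow4_sum_le _) _; rewrite card_ord ler_wpM2l ?exprn_ge0 //.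
by apply: ler_sum => j _; exact: dyadic_increment_pow4_le.
Qed.

Lemma dyadic_interval_pow4_le f (l m : nat) : (l < 2 ^ K)%N -> (m < 2 ^ K)%N ->
  `|f m - f l| ^+ 4 <= 16 * K%:R ^+ 3 * dyadic_pow4_sum f.
Proof.
move=> lK mK.
have [l_le m_le] := (dyadic_prefix_pow4_le f lK, dyadic_prefix_pow4_le f mK).
have := pow4_sum_le (fun b : bool => `|f (if b then m else l) - f 0%N|).
rewrite card_bool !big_bool /= => sum_le.
apply: (@le_trans _ _ ((`|f m - f 0%N| + `|f l - f 0%N|) ^+ 4)).
  rewrite lerXn2r ?nnegrE ?addr_ge0 //.
  by rewrite (le_trans _ (ler_normB _ _)) // opprB addrA subrK.
by apply: le_trans sum_le _; lra.
Qed.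

(* A Rademacher-Menshov inequality: the endpoints may depend on [x] at the cost
   of a power of [K]. *)
Lemma rademacher_menshov_pow4 (J : finType) (f : J -> nat -> V) (E : R)
    (l m : J -> nat) :
  (forall a b, (a <= b)%N ->
    \sum_x `|f x b - f x a| ^+ 4 <= (b - a)%:R ^+ 2 * E) ->
  (forall x, (l x < 2 ^ K)%N) -> (forall x, (m x < 2 ^ K)%N) ->
  \sum_x `|f x (m x) - f x (l x)| ^+ 4 <= 16 * K%:R ^+ 4 * 4 ^+ K * E.
Proof.
move=> fE lK mK.
have E0 : 0 <= E.
  have := fE 0%N 1%N isT; rewrite expr1n mul1r; apply: le_trans.
  by apply: sumr_ge0 => x _; rewrite exprn_ge0.
apply: (@le_trans _ _ (\sum_x 16 * K%:R ^+ 3 * dyadic_pow4_sum (f x))).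
  by apply: ler_sum => x _; exact: dyadic_interval_pow4_le.
rewrite -mulr_sumr (exprSr K%:R 3) -!mulrA !ler_wpM2l ?exprn_ge0 //.
rewrite exchange_big mulr_natl -[X in _ *+ X]card_ord -sumr_const.
apply: ler_sum => j _; rewrite exchange_big /=.
apply: (@le_trans _ _ (\sum_(b < 2 ^ (K - j)) (2 ^ j)%:R ^+ 2 * E)).
  apply: ler_sum => b _; rewrite -[X in (X%:R ^+ 2)%R](addKn (b * 2 ^ j)).
  by rewrite addnC -mulSn fE ?leq_mul.
rewrite sumr_const card_ord -[leLHS]mulr_natl [leLHS]mulrA ler_wpM2r //.
rewrite -!natrX -natrM ler_nat -expnM -expnD -[4%N]/(2 ^ 2)%N -expnM leq_exp2l //.
by have := ltn_ord j; lia.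
Qed.

End DyadicChaining.

Lemma nat_convex_interval (P : pred nat) (U : nat) :
  (forall i j k, (i <= j <= k)%N -> (k < U)%N -> P i -> P k -> P j) ->
  exists l m, (l <= m <= U)%N /\ forall i, (i < U)%N -> P i = (l <= i < m)%N.
Proof.
move=> P_convex; pose Q i := (i < U)%N && P i.
have [/existsP[i0 Qi0]|/existsPn notQ] := boolP [exists i : 'I_U, P i]; last first.
  exists 0%N, 0%N; split=> // i iU; rewrite ltn0 andbF.
  exact: negPf (notQ (Ordinal iU)).
have exQ : exists i, Q i by exists i0; rewrite /Q ltn_ord.
have Q_le i : Q i -> (i <= U)%N by move=> /andP[/ltnW].
have [l /andP[lU Pl] l_min] := ex_minnP exQ.
have [m /andP[mU Pm] m_max] := ex_maxnP exQ Q_le.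
exists l, m.+1; split=> [|i iU].
  by rewrite mU (leq_trans (m_max l _)) // /Q lU.
apply/idP/andP => [Pi|[li im]]; last by apply: (P_convex l i m); rewrite ?li.
by rewrite l_min ?ltnS ?m_max // /Q iU.
Qed.

Lemma convex_set_row (R : realFieldType) (E : lmodType R) (C : set (R^o * E))
    (i j k : R) (y : E) :
  convex_set C -> i <= j <= k -> C (i, y) -> C (k, y) -> C (j, y).
Proof.
move=> C_convex /andP[ij jk] Ci Ck.
have [ik|ik] := eqVneq i k.
  by have -> : j = i by apply/eqP; rewrite eq_le ij andbT [leRHS]ik.
have ki : 0 < k - i by rewrite subr_gt0 lt_neqAle ik (le_trans ij).
pose t := (k - j) / (k - i).
have t0 : 0 <= t by rewrite divr_ge0 ?subr_ge0 ?(le_trans ij).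
have t1 : t <= 1 by rewrite ler_pdivrMr // mul1r lerB.
have := C_convex _ _ (Itv01 t0 t1) (mem_set Ci) (mem_set Ck); rewrite inE.
congr C; rewrite /conv /=; congr pair.
  by rewrite -[LHS]/(t * i + (1 - t) * k) /t; field; rewrite gt_eqF.
by rewrite -[LHS]/(t *: y + (1 - t) *: y) -scalerDl addrC subrK scale1r.
Qed.

Lemma add_inv_hyperbola (F : fieldType) (x y s : F) :
  x != 0 -> y != 0 -> s != 0 -> x^-1 + y^-1 = s ->
  (x - s^-1) * (y - s^-1) = s ^- 2.
Proof.
move=> x0 y0 s0 xys; have s_xy : s * (x * y) = x + y.
  by rewrite -xys; field; rewrite x0 y0.
have -> : (x - s^-1) * (y - s^-1) = (s * (x * y) - (x + y)) / s + s ^- 2 by field.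
by rewrite s_xy subrr mul0r add0r.
Qed.

Lemma natr_Fp_inj (p i j : nat) : prime p -> (i < p)%N -> (j < p)%N ->
  i%:R = j%:R :> 'F_p -> i = j.
Proof.
move=> p_pr ip jp /(congr1 (fun x : 'F_p => nat_of_ord x)).
by rewrite !val_Fp_nat // !modn_small.
Qed.

Section ReciprocalsOfLinearForm.
Variables (R : realType) (p U : nat) (a b : 'F_p).
Hypotheses (p_pr : prime p) (Up : (0 < U < p)%N) (a0 : a != 0).

(* The index is shifted by one: [i : 'I_U] stands for [u = i + 1]. *)
Definition lin_form (i : nat) : 'F_p := a * i.+1%:R + b.

Definition inv_lin_form (i : 'I_U) : 'F_p := (lin_form i)^-1.

Lemma inv_lin_form_inj : injective inv_lin_form.
Proof.
move=> i j /invr_inj /addIr /(mulfI a0) ij; apply: val_inj; case/andP: Up => _ ltUp.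
by apply/eq_add_S/(natr_Fp_inj p_pr) => //; exact: leq_ltn_trans (ltn_ord _) ltUp.
Qed.

Variable P : {pred 'I_U}.
Hypothesis P_neq0 : {in P, forall i : 'I_U, lin_form i != 0}.

Lemma card_add_reps_inv_lin_form (s : 'F_p) : s != 0 ->
  (#|add_reps P inv_lin_form s| <=
   #|hyperbola_points U (1 + (b - s^-1) / a)%R ((a * s) ^- 2)%R|)%N.
Proof.
move=> s0; apply/subset_leq_card/fintype.subsetP => -[i j].
rewrite !inE => /and3P[/= /P_neq0 i0 /P_neq0 j0 /eqP ijs].
have shift (k : 'I_U) : k%:R + (1 + (b - s^-1) / a) = (lin_form k - s^-1) / a.
  rewrite /lin_form -natr1 mulrDr mulr1 -!addrA [RHS]mulrDl [a * _ / a]mulrAC.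
  by rewrite [(a + _) / a]mulrDl divff // mul1r.
rewrite !shift mulrACA (add_inv_hyperbola i0 j0 s0 ijs); apply/eqP.
by rewrite -invfM -expr2 -invfM -exprMn [s * a]mulrC.
Qed.

Definition energy_bound : R :=
  32 * (max_divisors (p ^ 4))%:R * (Num.sqrt (p * U ^ 3)%:R + p%:R).

Lemma energy_inv_lin_form_le :
  p%:R * (additive_energy P inv_lin_form)%:R <= #|P|%:R ^+ 2 * energy_bound.
Proof.
rewrite /energy_bound; have p0 : 0 < p%:R :> R by rewrite ltr0n prime_gt0.
set S : R := Num.sqrt _; set D : R := (max_divisors _)%:R.
have S0 : 0 <= S by exact: sqrtr_ge0.
have D1 : 1 <= D by rewrite ler1n max_divisors_gt0.
pose H : R := (10 * S + p%:R) * (2 * D).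
have repsH s : s != 0 -> #|add_reps P inv_lin_form s|%:R <= H / p%:R.
  move=> s0; rewrite ler_pdivlMr // mulrC.
  have as_neq0 : (a * s) ^- 2 != 0.
    by rewrite invr_eq0 expf_eq0 mulf_eq0 (negPf a0) (negPf s0).
  have := card_hyperbola_le R (1 + (b - s^-1) / a) p_pr _ as_neq0.
  rewrite natrM -/S -/D => /(_ U) le_H; apply: le_trans (le_H _); last first.
    by case/andP: Up => -> /ltnW ->.
  by rewrite ler_wpM2l ?ler_nat ?card_add_reps_inv_lin_form.
have H0 : 0 <= H by rewrite /H mulr_ge0 ?addr_ge0 ?mulr_ge0.
apply: (@le_trans _ _ (p%:R * (#|P|%:R ^+ 2 * (H / p%:R + 1)))).
  rewrite ler_wpM2l // additive_energy_le ?divr_ge0 //.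
  exact: (in2W inv_lin_form_inj).
rewrite mulrCA ler_wpM2l ?exprn_ge0 // mulrDr mulr1 mulrCA divff ?gt_eqF // mulr1.
have pD : p%:R <= p%:R * D by rewrite ler_peMr // ltW.
have SD : 0 <= S * D by rewrite mulr_ge0 // (le_trans ler01).
by rewrite /H; move: p0; lra.
Qed.

End ReciprocalsOfLinearForm.

Section Moment.
Variables (R : realType) (p U : nat) (a b : 'F_p) (alpha : nat -> R[i]).
Hypotheses (p_pr : prime p) (Up : (0 < U < p)%N) (a0 : a != 0).
Hypothesis alpha1 : forall u, (1 <= u <= U)%N -> normc (alpha u) <= 1.

Definition row_prefix (x : 'F_p) (n : nat) : R[i] :=
  \sum_(i < U | (lin_form a b i != 0) && (i < n)%N)
    alpha i.+1 * chi R (x * inv_lin_form a b i).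

Lemma row_prefixB (x : 'F_p) (m n : nat) : (m <= n)%N ->
  row_prefix x n - row_prefix x m =
  \sum_(i in [pred i : 'I_U | (lin_form a b i != 0) && (m <= i < n)%N])
    alpha i.+1 * chi R (x * inv_lin_form a b i).
Proof.
move=> mn; apply/eqP; rewrite subr_eq addrC; apply/eqP.
rewrite {1}/row_prefix (bigID (fun i : 'I_U => (i < m)%N)) /=.
by congr (_ + _); apply: eq_bigl => i; rewrite ?inE -andbA; congr (_ && _); lia.
Qed.

Lemma row_prefix_moment (m n : nat) : (m <= n)%N ->
  \sum_x normc (row_prefix x n - row_prefix x m) ^+ 4 <=
  (n - m)%:R ^+ 2 * energy_bound R p U.
Proof.
move=> mn; set P := [pred i : 'I_U | (lin_form a b i != 0) && (m <= i < n)%N].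
under eq_bigr do rewrite row_prefixB // -/P.
apply: le_trans (fourth_moment_le _ p_pr _) _ => [i _|].
  by apply: alpha1; exact: ltn_ord.
apply: le_trans (energy_inv_lin_form_le _ p_pr Up a0 _) _ => [i /andP[]//|].
rewrite ler_wpM2r ?mulr_ge0 ?addr_ge0 ?sqrtr_ge0 // lerXn2r ?nnegrE ?ler_nat //.
rewrite -(size_iota m (n - m)) cardE -(size_map (fun i : 'I_U => nat_of_ord i)).
apply: uniq_leq_size; first by rewrite map_inj_uniq ?enum_uniq //; exact: val_inj.
move=> k /mapP[j]; rewrite mem_enum => /andP[_ /andP[mj jn]] ->.
by rewrite mem_iota subnKC // mj.
Qed.

Variables (V : nat) (beta : nat -> R[i]) (C : set (R^o * R^o)).
Hypothesis Vp : (V < p)%N.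
Hypothesis beta1 : forall v, (1 <= v <= V)%N -> normc (beta v) <= 1.
Hypothesis C_convex : convex_set C.

Lemma Ksum_rows : exists l m : 'I_V -> nat,
  (forall v, (l v <= m v <= U)%N) /\
  Ksum U V a b alpha beta C =
  \sum_(v < V) beta v.+1 * (row_prefix v.+1%:R (m v) - row_prefix v.+1%:R (l v)).
Proof.
pose inC (v i : nat) := ((i.+1%:R, v.+1%:R) : R^o * R^o) \in C.
have row_interval (v : 'I_V) : exists lm : nat * nat, (lm.1 <= lm.2 <= U)%N /\
    forall i, (i < U)%N -> inC v i = (lm.1 <= i < lm.2)%N.
  have [|l [m lmP]] := @nat_convex_interval (inC v) U; last by exists (l, m).
  move=> i j k ijk _; rewrite /inC !inE; apply: convex_set_row => //.
  by rewrite !ler_nat !ltnS.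
have [lm lmP] := boolp.choice row_interval.
have lm_le v : ((lm v).1 <= (lm v).2 <= U)%N by case: (lmP v).
exists (fun v => (lm v).1), (fun v => (lm v).2); split=> //.
rewrite /Ksum; under eq_bigr do rewrite big_add1 big_mkord big_mkcond /=.
rewrite big_add1 big_mkord exchange_big /=; apply: eq_bigr => v _.
rewrite -big_mkcond row_prefixB; last by case/andP: (lm_le v).
rewrite mulr_sumr; apply: eq_big => [i|i _].
  by rewrite inE -(lmP v).2 // andbC.
by rewrite [RHS]mulrCA mulrA.
Qed.

Lemma Ksum_pow4_le_energy (K : nat) : (U < 2 ^ K)%N ->
  normc (Ksum U V a b alpha beta C) ^+ 4 <=
  V%:R ^+ 3 * (16 * K%:R ^+ 4 * 4 ^+ K * energy_bound R p U).
Proof.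
move=> UK; have [l [m [lmU ->]]] := Ksum_rows.
pose f (v : 'I_V) (n : nat) : Rcomplex R := row_prefix v.+1%:R n.
apply: (@le_trans _ _ ((\sum_(v < V) `|f v (m v) - f v (l v)|) ^+ 4)).
  rewrite lerXn2r ?nnegrE ?normc_ge0 ?sumr_ge0 //.
  apply: le_trans (normc_sum_le _ _ _) _; apply: ler_sum => v _.
  by rewrite normcM ler_piMl ?normc_ge0 // beta1 //; exact: ltn_ord.
apply: le_trans (pow4_sum_le _) _; rewrite card_ord ler_wpM2l ?exprn_ge0 //.
apply: rademacher_menshov_pow4 => [n1 n2 n12|v|v]; last 2 first.
- by have /andP[lm mU] := lmU v; exact: leq_ltn_trans (leq_trans lm mU) UK.
- by have /andP[_ mU] := lmU v; exact: leq_ltn_trans mU UK.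
apply: le_trans (row_prefix_moment n12).
have v_inj : injective (fun v : 'I_V => v.+1%:R : 'F_p).
  move=> u v /(natr_Fp_inj p_pr) uv; apply/val_inj/eq_add_S/uv.
    exact: leq_ltn_trans (ltn_ord u) Vp.
  exact: leq_ltn_trans (ltn_ord v) Vp.
pose G x := normc (row_prefix x n2 - row_prefix x n1) ^+ 4.
rewrite -(big_imset G (in2W v_inj)).
rewrite [leRHS](bigID (mem [set v.+1%:R | v : 'I_V]%SET)) /=.
by rewrite lerDl sumr_ge0 // => x _; rewrite exprn_ge0 ?normc_ge0.
Qed.

Lemma Ksum_pow4_le :
  normc (Ksum U V a b alpha beta C) ^+ 4 <=
  V%:R ^+ 3 * (U%:R ^+ 2 * (Num.sqrt (p * U ^ 3)%:R + p%:R)) *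
    (2 ^+ 11 * (max_divisors (p ^ 4))%:R ^+ 5).
Proof.
have /andP[U0 ltUp] := Up; pose K := (trunc_log 2 U).+1.
have UK : (U < 2 ^ K)%N by exact: trunc_log_ltn.
have KU : (2 ^ trunc_log 2 U <= U)%N by rewrite trunc_logP.
(* A power [2 ^ m] has [m + 1] divisors, which absorbs the logarithm. *)
have K_le : K%:R <= (max_divisors (p ^ 4))%:R :> R.
  rewrite ler_nat; apply: ltn_max_divisors; apply: leq_trans KU _.
  by apply: leq_trans (ltnW ltUp) _; rewrite -{1}(expn1 p) leq_exp2l ?prime_gt1.
have K4_le : 4 ^+ K <= 4 * U%:R ^+ 2 :> R.
  rewrite {1}/K exprS ler_wpM2l // -!natrX ler_nat -[4%N]/(2 ^ 2)%N.
  by rewrite -expnM mulnC expnM leq_exp2r.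
apply: le_trans (Ksum_pow4_le_energy UK) _.
rewrite -[leRHS]mulrA ler_wpM2l ?exprn_ge0 // /energy_bound.
set D : R := (max_divisors _)%:R in K_le *; set S : R := Num.sqrt _ + _.
have S0 : 0 <= S by rewrite addr_ge0 ?sqrtr_ge0.
rewrite [leRHS](_ : _ = 16 * D ^+ 4 * (4 * U%:R ^+ 2) * (32 * D * S)); last by ring.
rewrite ler_wpM2r ?mulr_ge0 // ler_pM ?mulr_ge0 ?exprn_ge0 //.
by rewrite ler_wpM2l // lerXn2r ?nnegrE.
Qed.

End Moment.

Lemma cvg_ln_natr (R : realType) : ln n%:R @[n --> \oo] --> (+oo : set_system R).
Proof.
apply/cvgryPge => A; near=> n.
have n0 : 0 < n%:R :> R by rewrite ltr0n; near: n; exact: nbhs_infty_gt.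
by rewrite -ler_expR lnK ?posrE //; near: n; exact: nbhs_infty_ger.
Unshelve. all: by end_near. Qed.

Lemma ln_max_divisors_le (R : realType) (k N : nat) : (0 < k)%N -> (0 < N)%N ->
  k%:R * ln (max_divisors N)%:R <= ln ((k ^ k) ^ (2 ^ k))%:R + ln N%:R :> R.
Proof.
move=> k0 N0; have D0 := max_divisors_gt0 N.
rewrite mulr_natl -lnXn ?ltr0n // -lnM ?posrE ?ltr0n ?expn_gt0 ?k0 //.
by rewrite ler_ln ?posrE -?natrX -?natrM ?ltr0n ?muln_gt0 ?expn_gt0 ?k0 ?D0 //
  ler_nat max_divisors_exp_le.
Qed.

Lemma cvg_ln_max_divisors (R : realType) :
  ln (max_divisors N)%:R / ln N%:R @[N --> \oo] --> (0 : R).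
Proof.
apply/cvgrPdist_le => e e0.
pose k := (Num.truncn (2 / e)).+1.
have ek : 2 <= e * k%:R by rewrite mulrC -ler_pdivrMr // ltW // truncnS_gt.
have k1 : 1 <= k%:R :> R by rewrite ler1n.
pose c : R := ln ((k ^ k) ^ (2 ^ k))%:R.
have ln_large : \forall N \near \oo, 2 * c / e <= ln N%:R.
  by move/cvgryPge: (@cvg_ln_natr R).
near=> N.
have N1 : (1 < N)%N by near: N; exact: nbhs_infty_gt.
have lnN : 0 < ln N%:R :> R by rewrite ln_gt0 // ltr1n.
have c_le : 2 * c <= e * ln N%:R by rewrite [leRHS]mulrC -ler_pdivrMr //; near: N.
rewrite sub0r normrN ger0_norm;
  last by rewrite divr_ge0 ?(ltW lnN) ?ln_ge0 ?ler1n ?max_divisors_gt0.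
rewrite ler_pdivrMr // -(ler_pM2l (lt_le_trans ltr01 k1)).
apply: le_trans (ln_max_divisors_le R _ (ltnW N1)) _ => //; rewrite -/c.
have := ler_wpM2r (ltW lnN) ek; have := ler_wpM2r (mulr_ge0 (ltW e0) (ltW lnN)) k1.
by lra.
Unshelve. all: by end_near. Qed.

Definition loss_factor (R : realType) (p : nat) : R :=
  2 ^+ 11 * (max_divisors (p ^ 4))%:R ^+ 5.

Definition loss_exponent (R : realType) (p : nat) : R :=
  ln (loss_factor R p) / (4 * ln p%:R).

Lemma loss_factor_gt0 (R : realType) (p : nat) : 0 < loss_factor R p.
Proof. by rewrite mulr_gt0 ?exprn_gt0 ?ltr0n ?max_divisors_gt0. Qed.

Lemma powR_loss_exponent (R : realType) (p : nat) : (1 < p)%N ->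
  p%:R `^ (loss_exponent R p * 4) = loss_factor R p.
Proof.
move=> p1; have lnp : 0 < ln p%:R :> R by rewrite ln_gt0 // ltr1n.
rewrite -[RHS]lnK ?posrE ?loss_factor_gt0 // /powR gt_eqF ?ltr0n ?(ltnW p1) //.
by rewrite /loss_exponent; congr expR; field; rewrite gt_eqF.
Qed.

Lemma loss_exponentE (R : realType) (p : nat) : (1 < p)%N ->
  loss_exponent R p = ln (2 ^+ 11) / 4 * (ln p%:R)^-1 +
    5 * (ln (max_divisors (p ^ 4))%:R / ln (p ^ 4)%:R).
Proof.
move=> p1; have lnp : 0 < ln p%:R :> R by rewrite ln_gt0 // ltr1n.
have D0 : 0 < (max_divisors (p ^ 4))%:R :> R by rewrite ltr0n max_divisors_gt0.
rewrite /loss_exponent lnM ?posrE ?exprn_gt0 // natrX.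
rewrite !lnXn ?ltr0n ?max_divisors_gt0 ?(ltnW p1) //.
by rewrite -![ln _ *+ _]mulr_natl; field; rewrite gt_eqF.
Qed.

Lemma cvg_expn_infty (k : nat) : (0 < k)%N -> (n ^ k)%N @[n --> \oo] --> \oo.
Proof.
move=> k0; apply/cvgnyPge => A; exists A.+1 => // n /= An.
by rewrite (leq_trans (ltnW An)) // -{1}(expn1 n) leq_pexp2l // (leq_trans _ An).
Qed.

Lemma loss_exponent_cvg0 (R : realType) : loss_exponent R @ \oo --> (0 : R).
Proof.
have inv_ln_cvg0 : (ln n%:R)^-1 @[n --> \oo] --> (0 : R).
  apply/gtr0_cvgV0; last exact: cvg_ln_natr.
  by exists 2%N => // n /= n2; rewrite ln_gt0 // ltr1n.
have ln_divisors_cvg0 :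
    ln (max_divisors (p ^ 4))%:R / ln (p ^ 4)%:R @[p --> \oo] --> (0 : R).
  exact: (cvg_comp (expn^~ 4%N) (fun N => ln (max_divisors N)%:R / ln N%:R)
    (@cvg_expn_infty 4 isT) (@cvg_ln_max_divisors R)).
have eq_near : \forall p \near \oo, ln (2 ^+ 11) / 4 * (ln p%:R)^-1 +
    5 * (ln (max_divisors (p ^ 4))%:R / ln (p ^ 4)%:R) = loss_exponent R p.
  by exists 2%N => // p /= p2; rewrite loss_exponentE.
apply: cvg_trans (near_eq_cvg eq_near) _.
have := cvgD (cvgM (cvg_cst (ln (2 ^+ 11) / 4)) inv_ln_cvg0)
  (cvgM (cvg_cst (5 : R)) ln_divisors_cvg0).
by rewrite !mulr0 addr0; exact.
Qed.

Lemma powR_pow4 (R : realType) (x y : R) : (x `^ y) ^+ 4 = x `^ (y * 4).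
Proof. by rewrite -powR_mulrn ?powR_ge0 // -powRrM. Qed.

Lemma pow4_add_ge (R : realDomainType) (x y : R) : 0 <= x -> 0 <= y ->
  x ^+ 4 + y ^+ 4 <= (x + y) ^+ 4.
Proof.
move=> x0 y0; rewrite -subr_ge0.
have -> : (x + y) ^+ 4 - (x ^+ 4 + y ^+ 4) =
  4 * x ^+ 3 * y + 6 * x ^+ 2 * y ^+ 2 + 4 * x * y ^+ 3 by ring.
by rewrite !addr_ge0 // !mulr_ge0 // exprn_ge0.
Qed.

Lemma powR_bound_pow4_ge (R : realType) (p U V : nat) (e : R) :
  (0 < p)%N -> (0 < U)%N ->
  V%:R ^+ 3 * (U%:R ^+ 2 * (Num.sqrt (p * U ^ 3)%:R + p%:R)) * p%:R `^ (e * 4) <=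
  (V%:R `^ (3 / 4) *
    (U%:R `^ (7 / 8) * p%:R `^ (1 / 8) + U%:R `^ (1 / 2) * p%:R `^ (1 / 4)) *
    p%:R `^ e) ^+ 4.
Proof.
move=> p0 U0.
have V_pow4 : (V%:R `^ (3 / 4)) ^+ 4 = V%:R ^+ 3 :> R.
  by rewrite powR_pow4 divfK // powR_mulrn.
have sqrt_powR : Num.sqrt (p * U ^ 3)%:R = U%:R `^ (3 / 2) * p%:R `^ (1 / 2) :> R.
  rewrite -powR12_sqrt // mulnC natrM natrX powRM ?exprn_ge0 // -powR_mulrn //.
  by rewrite -powRrM mul1r.
have first_pow4 : (U%:R `^ (7 / 8) * p%:R `^ (1 / 8)) ^+ 4 =
    U%:R ^+ 2 * Num.sqrt (p * U ^ 3)%:R :> R.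
  rewrite sqrt_powR exprMn !powR_pow4 mulrA -(powR_mulrn 2) // -powRD; last first.
    by rewrite pnatr_eq0 -lt0n U0 implybT.
  by congr (_ `^ _ * _ `^ _); field.
have second_pow4 : (U%:R `^ (1 / 2) * p%:R `^ (1 / 4)) ^+ 4 = U%:R ^+ 2 * p%:R :> R.
  rewrite exprMn !powR_pow4 (_ : 1 / 2 * 4 = 2%:R :> R); last by field.
  by rewrite divfK // powRr1 // powR_mulrn.
rewrite !exprMn V_pow4 powR_pow4 ler_wpM2r ?powR_ge0 // ler_wpM2l ?exprn_ge0 //.
by rewrite mulrDr -first_pow4 -second_pow4 pow4_add_ge ?mulr_ge0 ?powR_ge0.
Qed.

Theorem theorem2p4 (R : realType) :
  exists eps : nat -> R,
    eps @ \oo --> (0 : R) /\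
    forall (p U V : nat) (a b : 'F_p) (C : set (R^o * R^o))
           (alpha beta : nat -> R[i]),
      prime p ->
      (1 <= U < p)%N -> (1 <= V < p)%N ->
      a != 0 ->
      C `<=` (`[1, U%:R] `*` `[1, V%:R]) ->
      convex_set C ->
      (forall u : nat, (1 <= u <= U)%N -> `|alpha u| <= 1) ->
      (forall v : nat, (1 <= v <= V)%N -> `|beta v| <= 1) ->
      `|Ksum U V a b alpha beta C| <=
        (V%:R `^ (3 / 4) *
         (U%:R `^ (7 / 8) * p%:R `^ (1 / 8) + U%:R `^ (1 / 2) * p%:R `^ (1 / 4)) *
         p%:R `^ (eps p))%:C.
Proof.
exists (loss_exponent R); split; first exact: loss_exponent_cvg0.
move=> p U V a b C alpha beta p_pr U_lt /andP[_ V_lt] a0 _ C_convex alpha1 beta1.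
have normc_le1 z : `|z| <= 1 -> normc z <= 1 :> R by rewrite -lecR.
have alpha_le1 u : (1 <= u <= U)%N -> normc (alpha u) <= 1 by move/alpha1/normc_le1.
have beta_le1 v : (1 <= v <= V)%N -> normc (beta v) <= 1 by move/beta1/normc_le1.
set bound := (X in _ <= X%:C).
have bound_ge0 : 0 <= bound by rewrite !mulr_ge0 ?addr_ge0 ?mulr_ge0 ?powR_ge0.
suff : normc (Ksum U V a b alpha beta C) <= bound by rewrite -lecR.
rewrite -(@ler_pXn2r _ 4) ?nnegrE ?normc_ge0 //.
have [[U_gt0 _] p_gt1] := (andP U_lt, prime_gt1 p_pr).
apply: le_trans (powR_bound_pow4_ge V (loss_exponent R p) (ltnW p_gt1) U_gt0).
by rewrite powR_loss_exponent //; exact: Ksum_pow4_le.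
Qed.
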